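(* Let $\mathcal{M}$ be an oriented matroid on the ground set $E=\{1,\dots,n\}\cup\{f\}$, and let ${}_{-f}\mathcal{M}^*$ denote the oriented matroid dual to $\mathcal{M}$ with the element $f$ reoriented. Then the Alexander dual (with respect to the vertex set $V=\{x_1,\dots,x_n,y_1,\dots,y_n\}$) of the simplicial complex $\Delta(\mathcal{M},f)$ is the simplicial complex $\Delta({}_{-f}\mathcal{M}^*,f)$.
   Context: Signed cocircuits of an oriented matroid are written $C=(C^+,C^-)$. For an oriented matroid $\mathcal{N}$ on $\{1,\dots,n\}\cup\{f\}$, the simplicial complex $\Delta(\mathcal{N},f)$ on the vertex set $V=\{x_1,\dots,x_n,y_1,\dots,y_n\}$ is the complex whose facets (maximal faces) are the sets $V\setminus\big(\{x_i : i\in C^+\setminus\{f\}\}\cup\{y_j : j\in C^-\}\big)$, where $C=(C^+,C^-)$ runs over all signed cocircuits of $\mathcal{N}$ with $f\in C^+$. The oriented matroid ${}_{-f}\mathcal{M}^*$ is obtained from the dual $\mathcal{M}^*$ by reversing the sign of $f$ in all signed sets. For a simplicial complex $K$ on vertex set $V$, its Alexander dual is $K^\vee=\{V\setminus\sigma : \sigma\subseteq V,\ \sigma\notin K\}$. *)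

(* Defs.v *)
From HB Require Import structures.
From mathcomp Require Import all_boot.

Set Implicit Arguments.
Unset Strict Implicit.
Unset Printing Implicit Defensive.

Section SignedSets.

Variable E : finType.

Record signed_set := SignedSet {
  pos_neg : {set E} * {set E};
  pos_neg_disjoint : [disjoint pos_neg.1 & pos_neg.2]
}.

HB.instance Definition _ := [isSub for pos_neg].
HB.instance Definition _ := [Finite of signed_set by <:].

Implicit Types X Y Z : signed_set.

Definition pos X : {set E} := (pos_neg X).1.
Definition neg X : {set E} := (pos_neg X).2.
Definition supp X : {set E} := pos X :|: neg X.

Fact opp_subproof X : [disjoint (neg X, pos X).1 & (neg X, pos X).2].
Proof. by rewrite disjoint_sym; apply: pos_neg_disjoint. Qed.

Definition opp X : signed_set := SignedSet (opp_subproof X).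

Definition reorient_pair (f : E) X : {set E} * {set E} :=
  (pos X :\ f :|: neg X :&: [set f], neg X :\ f :|: pos X :&: [set f]).

Fact reorient_subproof f X :
  [disjoint (reorient_pair f X).1 & (reorient_pair f X).2].
Proof.
rewrite disjoint_subset; apply/subsetP => e; rewrite !inE.
have /pred0P/(_ e)/= := pos_neg_disjoint X.
rewrite -/(pos X) -/(neg X).
by case: (e == f); case: (e \in pos X); case: (e \in neg X).
Qed.

Definition reorient f X : signed_set := SignedSet (reorient_subproof f X).

Definition agreement X Y : {set E} :=
  pos X :&: pos Y :|: neg X :&: neg Y.

Definition separation X Y : {set E} :=
  pos X :&: neg Y :|: neg X :&: pos Y.

(* The restrictions of [X] and [Y] to the intersection of their supports are
   neither equal nor opposite, unless that intersection is empty. *)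
Definition orthogonal X Y : bool :=
  [disjoint supp X & supp Y]
  || (agreement X Y != set0) && (separation X Y != set0).

End SignedSets.

Record oriented_matroid (E : finType) := OrientedMatroid {
  circuits : {set signed_set E};
  circuit_neq0 : forall X, X \in circuits -> supp X != set0;
  circuit_opp : forall X, X \in circuits -> opp X \in circuits;
  circuit_incomparable : forall X Y, X \in circuits -> Y \in circuits ->
    supp X \subset supp Y -> X = Y \/ X = opp Y;
  circuit_elimination : forall X Y e, X \in circuits -> Y \in circuits ->
    X <> opp Y -> e \in pos X -> e \in neg Y ->
    exists2 Z, Z \in circuits &
      pos Z \subset (pos X :|: pos Y) :\ e /\
      neg Z \subset (neg X :|: neg Y) :\ e
}.

Definition covectors (E : finType) (C : {set signed_set E}) :
    {set signed_set E} :=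
  [set Y | [forall X in C, orthogonal X Y]].

Definition min_supp (E : finType) (S : {set signed_set E}) :
    {set signed_set E} :=
  [set X in S | (supp X != set0) &&
    [forall Y in S, (supp Y != set0) ==> ~~ (supp Y \proper supp X)]].

Definition cocircuits (E : finType) (M : oriented_matroid E) :
    {set signed_set E} :=
  min_supp (covectors (circuits M)).

Section Parts.

Variable E : finType.
Implicit Types X Y Z W T : signed_set E.

Definition part (b : bool) X : {set E} := if b then pos X else neg X.

Lemma part_opp b X : part b (opp X) = part (~~ b) X.
Proof. by case: b. Qed.

Lemma oppK X : opp (opp X) = X.
Proof. by apply: val_inj; case: X => [[]]. Qed.

Lemma partN b X e : e \in part b X -> e \in part (~~ b) X = false.
Proof.
have /pred0P/(_ e)/= := pos_neg_disjoint X; rewrite -/(pos X) -/(neg X).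
by case: b => /=; case: (e \in pos X); case: (e \in neg X).
Qed.

Lemma suppP X e : reflect (exists b, e \in part b X) (e \in supp X).
Proof.
apply: (iffP setUP) => [[h|h]|[[] h]]; [by exists true|by exists false|by left|by right].
Qed.

Lemma supp_part b X e : e \in part b X -> e \in supp X.
Proof. by move=> h; apply/suppP; exists b. Qed.

Lemma supp_opp X : supp (opp X) = supp X.
Proof. by rewrite /supp setUC. Qed.

Lemma signed_set_eq X Y : (forall b, part b X = part b Y) -> X = Y.
Proof.
move=> h; apply: val_inj; have := (h true, h false) => -[] /=.
by case: X Y {h} => [[? ?] ?] [[? ?] ?] /=; rewrite /pos /neg /= => -> ->.
Qed.

Lemma agreementP X Y e :
  reflect (exists b, e \in part b X /\ e \in part b Y) (e \in agreement X Y).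
Proof.
rewrite !inE; apply: (iffP orP) => [[]/andP[]|[[] []]] /=.
- by exists true.
- by exists false.
- by left; apply/andP.
- by right; apply/andP.
Qed.

Lemma separationP X Y e :
  reflect (exists b, e \in part b X /\ e \in part (~~ b) Y)
          (e \in separation X Y).
Proof.
rewrite !inE; apply: (iffP orP) => [[]/andP[]|[[] []]] /=.
- by exists true.
- by exists false.
- by left; apply/andP.
- by right; apply/andP.
Qed.

Lemma orthogonalI X Y :
  (forall e b, e \in part b X -> e \in part b Y ->
     exists e' b', e' \in part b' X /\ e' \in part (~~ b') Y) ->
  (forall e b, e \in part b X -> e \in part (~~ b) Y ->
     exists e' b', e' \in part b' X /\ e' \in part b' Y) ->
  orthogonal X Y.
Proof.
move=> h1 h2; rewrite /orthogonal; case: (boolP [disjoint _ & _]) => //=.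
case/pred0Pn=> e /=/andP[/suppP[b eX] /suppP[b' eY]].
case: (eqVneq b b') eY => [<-|] eY.
  apply/andP; split; apply/set0Pn; first by exists e; apply/agreementP; exists b.
  by have [e' [d ?]] := h1 e b eX eY; exists e'; apply/separationP; exists d.
move=> eY'; have {}eY' : e \in part (~~ b) Y by case: b b' eY eY' {eX} => [] [].
apply/andP; split; apply/set0Pn; last by exists e; apply/separationP; exists b.
by have [e' [d ?]] := h2 e b eX eY'; exists e'; apply/agreementP; exists d.
Qed.

Lemma orthogonalS X Y e b : orthogonal X Y ->
  e \in part b X -> e \in part b Y ->
  exists e' b', e' \in part b' X /\ e' \in part (~~ b') Y.
Proof.
move=> /orP[/pred0P/(_ e)/= |] + eX eY.
  by rewrite (supp_part eX) (supp_part eY).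
by case/andP=> _ /set0Pn[e' /separationP[d ?]]; exists e', d.
Qed.

Lemma orthogonalA X Y e b : orthogonal X Y ->
  e \in part b X -> e \in part (~~ b) Y ->
  exists e' b', e' \in part b' X /\ e' \in part b' Y.
Proof.
move=> /orP[/pred0P/(_ e)/= |] + eX eY.
  by rewrite (supp_part eX) (supp_part eY).
by case/andP=> /set0Pn[e' /agreementP[d ?]] _; exists e', d.
Qed.

Lemma orthogonal_oppr X Y : orthogonal X (opp Y) = orthogonal X Y.
Proof.
suff h (A B : signed_set E) : orthogonal A B -> orthogonal A (opp B).
  by apply/idP/idP => [/h|/h //]; rewrite oppK.
move=> o; apply: orthogonalI => e b.
  rewrite part_opp => eA eB; have [e' [d]] := orthogonalA o eA eB.
  by exists e', d; rewrite part_opp negbK.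
rewrite part_opp negbK => eA eB; have [e' [d]] := orthogonalS o eA eB.
by exists e', d; rewrite part_opp.
Qed.

Definition strong_elim (C : {set signed_set E}) X Y : Prop :=
  forall b c g e, g \in part b X -> g \in part (~~ b) Y ->
    e \in part c X -> e \notin part (~~ c) Y ->
  exists Z, [/\ Z \in C, e \in part c Z, g \notin supp Z &
    forall d k, k \in part d Z -> k \in part d X \/ k \in part d Y].

Lemma supp_sub_cover X Y Z :
  (forall d k, k \in part d Z -> k \in part d X \/ k \in part d Y) ->
  supp Z \subset supp X :|: supp Y.
Proof.
move=> h; apply/subsetP => k /suppP[d /h[] /supp_part kS];
by rewrite inE kS ?orbT.
Qed.

End Parts.

Section Duality.

Variables (E : finType) (M : oriented_matroid E).
Implicit Types X Y Z W T : signed_set E.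
Local Notation C := (circuits M).
Local Notation D := (covectors (circuits M)).

Lemma weak_elim X Y b g : X \in C -> Y \in C -> X <> opp Y ->
  g \in part b X -> g \in part (~~ b) Y ->
  exists Z, [/\ Z \in C, g \notin supp Z &
    forall d k, k \in part d Z -> k \in part d X \/ k \in part d Y].
Proof.
wlog -> : X Y b / b = true => [hw|XC YC nXY gX gY].
  case: b => XC YC nXY gX gY; first exact: (hw X Y true).
  have nYX : Y <> opp X by move=> eY; apply: nXY; rewrite eY oppK.
  have [Z [ZC gZ h]] := hw Y X true erefl YC XC nYX gY gX.
  by exists Z; split=> // d k kZ; case: (h d k kZ); [right|left].
have [Z ZC [/subsetP sp /subsetP sn]] := circuit_elimination XC YC nXY gX gY.
exists Z; split=> //.
  by apply/negP; rewrite inE => /orP[/sp|/sn]; rewrite !inE eqxx.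
by case=> k /=; [move/sp|move/sn]; rewrite !inE => /andP[_ /orP].
Qed.

Lemma strong_elim_step m :
  (forall X Y, X \in C -> Y \in C -> #|supp X :|: supp Y| < m ->
     strong_elim C X Y) ->
  forall X Y b c g e, X \in C -> Y \in C -> #|supp X :|: supp Y| <= m ->
    g \in part b X -> g \in part (~~ b) Y ->
    e \in part c X -> e \notin part (~~ c) Y ->
    (forall Z h d, Z \in C -> supp Z \subset supp X :|: supp Y ->
       e \notin supp Z -> g \notin supp Z ->
       h \in part d Y -> h \in part (~~ d) (opp Z) ->
       exists Y', [/\ Y' \in C, g \in part (~~ b) Y', h \notin supp Y' &
         forall d k, k \in part d Y' -> k \in part d Y \/ k \in part d (opp Z)]) ->
  exists Z, [/\ Z \in C, e \in part c Z, g \notin supp Z &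
    forall d k, k \in part d Z -> k \in part d X \/ k \in part d Y].
Proof.
move=> IH X Y b c g e XC YC leS gX gY eX eY elimYZ.
have nXY : X <> opp Y.
  by move=> eXY; move: eX; rewrite eXY part_opp (negbTE eY).
have [Z [ZC gZ hZ]] := weak_elim XC YC nXY gX gY.
case: (boolP (e \in supp Z)) => [/suppP[d eZ]|eZ].
  exists Z; split=> //; case: (eqVneq c d) eZ => [->//|ncd] eZ.
  have {}eZ : e \in part (~~ c) Z by case: c d ncd eZ {eX eY elimYZ} => [] [].
  by case: (hZ _ _ eZ) => h; [rewrite (partN eX) in h|rewrite h in eY].
have sZ := supp_sub_cover hZ.
have fix_bad k W : #|separation W Z| <= k -> W \in C -> e \in part c W ->
    g \notin supp W ->
    (forall d j, j \in part d W ->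
       [\/ j \in part d X, j \in part d Y | j \in part (~~ d) Z]) ->
    exists Z, [/\ Z \in C, e \in part c Z, g \notin supp Z &
      forall d k, k \in part d Z -> k \in part d X \/ k \in part d Y].
  elim: k W => [|k IHk] W lek WC eW gW hW.
    exists W; split=> // d j jW; case: (hW _ _ jW); [by left|by right|] => jZ.
    have : j \in separation W Z by apply/separationP; exists d.
    by move: lek; rewrite leqn0 cards_eq0 => /eqP->; rewrite inE.
  have [s0|[j jS]] := set_0Vmem (separation W Z).
    by apply: (IHk W) => //; rewrite s0 cards0.
  have /separationP[d [jW jZ]] := jS.
  have sWZ : supp W :|: supp Z \subset (supp X :|: supp Y) :\ g.
    apply/subsetP => i; rewrite inE => iWZ; rewrite 2!inE.
    apply/andP; split.
      by apply: contraTneq iWZ => ->; rewrite (negbTE gW) (negbTE gZ).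
    case/orP: iWZ => [/suppP[u /hW[]/supp_part]|/(subsetP sZ)//].
    - by move=> iX; rewrite inE iX.
    - by move=> iY; rewrite inE iY orbT.
    - by move/(subsetP sZ).
  have ltm : #|supp W :|: supp Z| < m.
    apply: leq_ltn_trans (subset_leq_card sWZ) _; apply: leq_trans leS.
    by rewrite [X in _ < X](cardsD1 g) inE (supp_part gX).
  have eZ' : e \notin part (~~ c) Z by apply: contra eZ => /supp_part.
  have [W' [W'C eW' jW' hW']] := IH W Z WC ZC ltm d c j e jW jZ eW eZ'.
  apply: (IHk W') => //.
  - rewrite -ltnS; apply: leq_trans lek; apply: proper_card.
    apply/properP; split; last first.
      exists j => //; apply: contra jW' => /separationP[u [ju _]].
      exact: supp_part ju.
    apply/subsetP => i /separationP[u [iW' iZ]].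
    apply/separationP; exists u; split=> //; case: (hW' _ _ iW') => // iZ'.
    by rewrite (partN iZ') in iZ.
  - apply/negP => /suppP[u /hW'[]/supp_part]; exact/negP.
  - move=> u i /hW'[/hW//|/hZ[]]; [by constructor 1|by constructor 2].
have [h hZX hX] : exists2 h, h \in supp Z & h \notin supp X.
  apply/subsetPn; apply/negP => sZX.
  have := circuit_incomparable ZC XC sZX.
  have eX' := supp_part eX.
  by case=> eZX; rewrite eZX ?supp_opp eX' in eZ.
have /suppP[d hd] := hZX.
have hY : h \in part d Y.
  by case: (hZ _ _ hd) => // /supp_part; rewrite (negbTE hX).
have [|Y' [Y'C gY' hY' cY']] := elimYZ Z h d ZC sZ eZ gZ hY.
  by rewrite part_opp negbK.
have eY' : e \notin part (~~ c) Y'.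
  apply/negP => /cY'[|]; first exact/negP.
  by rewrite part_opp => /supp_part; apply/negP.
have ltm : #|supp X :|: supp Y'| < m.
  apply: leq_trans leS; apply: proper_card; apply/properP; split.
    apply/subsetP => i; rewrite inE => /orP[iX|]; first by rewrite inE iX.
    move/(subsetP (supp_sub_cover cY')); rewrite supp_opp inE => /orP[iY|].
      by rewrite inE iY orbT.
    exact: (subsetP sZ).
  exists h; first by rewrite inE (supp_part hY) orbT.
  by rewrite inE negb_or hX.
have [W [WC eW gW hW]] := IH X Y' XC Y'C ltm b c g e gX gY' eX eY'.
apply: (fix_bad _ W (leqnn _)) => // u i /hW[|/cY'[|]].
- by constructor 1.
- by constructor 2.
- by rewrite part_opp; constructor 3.
Qed.

Lemma circuit_strong_elim X Y : X \in C -> Y \in C -> strong_elim C X Y.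
Proof.
move=> XC YC; have [m] := ubnP #|supp X :|: supp Y|.
elim: m X Y XC YC => // m IH X Y XC YC; rewrite ltnS => leS.
have {}IH X' Y' : X' \in C -> Y' \in C -> #|supp X' :|: supp Y'| < m ->
  strong_elim C X' Y' by move=> *; apply: IH.
have step1 X' Y' b c g e : X' \in C -> Y' \in C ->
    #|supp X' :|: supp Y'| <= m ->
    g \in part b X' -> g \in part (~~ b) Y' ->
    e \in part c X' -> e \notin supp Y' ->
    exists Z, [/\ Z \in C, e \in part c Z, g \notin supp Z &
    forall d k, k \in part d Z -> k \in part d X' \/ k \in part d Y'].
  move=> XC' YC' leS' gX gY eX eY.
  apply: (strong_elim_step IH XC' YC' leS' gX gY eX).
    by apply: contra eY => /supp_part.
  move=> Z h d ZC sZ eZ gZ hY hZ.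
  have oZC : opp Z \in C by apply: circuit_opp.
  have ltm : #|supp Y' :|: supp (opp Z)| < m.
    apply: leq_trans leS'; rewrite supp_opp; apply: proper_card.
    apply/properP; split; first by rewrite subUset sZ subsetUr.
    exists e; first by rewrite inE (supp_part eX).
    by rewrite inE negb_or eY.
  apply: (IH Y' (opp Z) YC' oZC ltm d) => //.
  by rewrite part_opp; apply: contra gZ => /supp_part.
move=> b c g e gX gY eX eY.
apply: (strong_elim_step IH XC YC leS gX gY eX eY).
move=> Z h d ZC sZ eZ gZ hY hZ.
have oZC : opp Z \in C by apply: circuit_opp.
apply: (step1 Y (opp Z) d) => //; last by rewrite supp_opp.
apply: leq_trans leS; apply: subset_leq_card.
by rewrite supp_opp subUset sZ subsetUr.
Qed.

(* The painting (Farkas) lemma: [(i, b) \in P] when [i] may carry the sign [b]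
   in a circuit; a covector must avoid the opposite of every allowed sign. *)
Lemma painting (P : {set E * bool}) e c :
  (e, c) \in P -> (e, ~~ c) \notin P ->
  (exists T, [/\ T \in C, e \in part c T &
     forall d k, k \in part d T -> (k, d) \in P]) \/
  (exists Y, [/\ Y \in D, e \in part c Y &
     forall d k, k \in part d Y -> (k, ~~ d) \notin P]).
Proof.
move=> ecP eNcP.
pose graph T : {set E * bool} := [set p | p.1 \in part p.2 T].
have graphP T (Q : {set E * bool}) :
    reflect (forall d k, k \in part d T -> (k, d) \in Q) (graph T \subset Q).
  apply: (iffP subsetP) => [h d k kT|h [k d]]; first by apply: h; rewrite inE.
  by rewrite inE; apply: h.
pose bad (Q : {set E * bool}) :=
  [exists T in C, (e \in part c T) && (graph T \subset Q)].
case: (boolP (bad P)) => [/existsP[T /and3P[TC eT /graphP hT]]|nbP].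
  by left; exists T.
right; pose ok (Q : {set E * bool}) := ((e, ~~ c) \notin Q) && ~~ bad Q.
have [|Q maxQ sPQ] := @maxset_exists _ ok P; first by rewrite /ok eNcP.
have ecQ : (e, c) \in Q := subsetP sPQ _ ecP.
have /andP[eNcQ nbQ] := maxsetp maxQ.
have badQ T : T \in C -> e \in part c T ->
    (forall d k, k \in part d T -> (k, d) \in Q) -> False.
  move=> TC eT hT; case/negP: nbQ; apply/existsP; exists T.
  by rewrite TC eT; apply/graphP.
have addQ j d : (j, d) \notin Q -> j != e ->
    exists T, [/\ T \in C, e \in part c T, j \in part d T &
      forall u k, k \in part u T -> (k, u) = (j, d) \/ (k, u) \in Q].
  move=> jQ nje; have : ~~ ok ((j, d) |: Q).
    apply/negP => okQ; have eQ := maxsetsup maxQ okQ (subsetUr _ _).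
    by move: jQ; rewrite -eQ !inE eqxx.
  rewrite negb_and negbK negbK !inE (negbTE eNcQ) orbF.
  rewrite xpair_eqE eq_sym (negbTE nje) /=.
  case/existsP=> T /and3P[TC eT /graphP hT]; exists T; split=> //.
    apply: contraT => jT; case: (badQ T) => // u k kT.
    have := hT _ _ kT; rewrite !inE => /orP[/eqP[ek eu]|//].
    by rewrite ek eu (negbTE jT) in kT.
  by move=> u k /hT; rewrite !inE => /orP[/eqP|]; [left|right].
have neqe j d : (j, d) \notin Q -> (j, ~~ d) \notin Q -> False.
  move=> jQ jNQ.
  have nje : j != e.
    apply/eqP => je; rewrite je in jQ jNQ.
    by case: (d) (c) jQ jNQ ecQ => [] [] /= /negPf h1 /negPf h2; rewrite ?h1 ?h2.
  have [T1 [T1C eT1 jT1 hT1]] := addQ _ _ jQ nje.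
  have [T2 [T2C eT2 jT2 hT2]] := addQ _ _ jNQ nje.
  have eT2' : e \notin part (~~ c) T2 by rewrite (partN eT2).
  have [Z [ZC eZ jZ hZ]] := circuit_strong_elim T1C T2C jT1 jT2 eT1 eT2'.
  apply: (badQ Z) => // u k kZ.
  have nkj : k != j by apply: contraNneq jZ => <-; apply: supp_part kZ.
  by case: (hZ _ _ kZ) => [/hT1|/hT2] [[ekj]|//]; rewrite ekj eqxx in nkj.
pose pn := ([set j | (j, false) \notin Q], [set j | (j, true) \notin Q]).
have dpn : [disjoint pn.1 & pn.2].
  rewrite disjoint_subset; apply/subsetP => j; rewrite !inE => jF.
  by rewrite negbK; apply: contraT => jT; case: (neqe j false).
pose Y := SignedSet dpn.
have YE d k : (k \in part d Y) = ((k, ~~ d) \notin Q).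
  by case: d; rewrite inE.
exists Y; split; last 1 first.
- by move=> d k; rewrite YE; apply: contra => /(subsetP sPQ).
- rewrite inE; apply/forall_inP => X XC.
  have key X' : X' \in C -> forall j d, j \in part d X' -> j \in part d Y ->
      exists k u, k \in part u X' /\ k \in part (~~ u) Y.
    move=> X'C j d jX jY.
    case: (boolP [exists k, exists u, (k \in part u X') && (k \in part (~~ u) Y)]).
      by case/existsP=> k /existsP[u /andP[? ?]]; exists k, u.
    move/existsPn => nex.
    have sX u k : k \in part u X' -> (k, u) \in Q.
      move=> kX; have /existsPn/(_ u) := nex k.
      by rewrite kX YE !negbK.
    have eX : e \notin supp X'.
      apply/negP => /suppP[u eu]; have := sX _ _ eu.
      case: (eqVneq u c) eu => [->|nuc] eu.
        by move=> _; case: (badQ X').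
      have -> : u = ~~ c by case: u c nuc {eu ecP eNcP ecQ eNcQ nbQ badQ addQ
         nbP ok bad maxQ} => [] [].
      by rewrite (negbTE eNcQ).
    have nje : j != e by apply: contraNneq eX => <-; apply: supp_part jX.
    rewrite YE in jY; have [T [TC eT jT hT]] := addQ _ _ jY nje.
    have eX' : e \notin part (~~ c) X' by apply: contra eX => /supp_part.
    have [|Z [ZC eZ jZ hZ]] :=
      circuit_strong_elim TC X'C jT (_ : j \in part (~~ ~~ d) X') eT eX'.
      by rewrite negbK.
    case: (badQ Z) => // u k kZ.
    have nkj : k != j by apply: contraNneq jZ => <-; apply: supp_part kZ.
    by case: (hZ _ _ kZ) => [/hT[[ekj]|//]|/sX//]; rewrite ekj eqxx in nkj.
  apply: orthogonalI; first exact: key.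
  move=> j d jX jY.
  have [||k [u [kX kY]]] := key (opp X) (circuit_opp XC) j (~~ d).
  - by rewrite part_opp negbK.
  - by [].
  by rewrite part_opp in kX; exists k, (~~ u).
- by rewrite YE.
Qed.

Lemma covector_opp Y : Y \in D -> opp Y \in D.
Proof.
rewrite !inE => /forall_inP h; apply/forall_inP => X /h.
by rewrite orthogonal_oppr.
Qed.

Lemma covector_strong_elim X Y : X \in D -> Y \in D -> strong_elim D X Y.
Proof.
move=> XD YD b c g e gX gY eX eY.
pose P : {set E * bool} :=
  [set p | (p.1 == g) || (p.1 \notin part (~~ p.2) X :|: part (~~ p.2) Y)].
have PE k d : ((k, d) \in P) =
    (k == g) || (k \notin part (~~ d) X) && (k \notin part (~~ d) Y).
  by rewrite !inE negb_or.
have neg_g : e != g.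
  apply: contraNneq eY => eg; rewrite eg in eX *.
  suff -> : c = b by [].
  apply/eqP; apply: contraT => ncb.
  have : g \in part (~~ b) X by case: (b) (c) ncb eX => [] [].
  by rewrite (partN gX).
have [||[T [TC eT hT]]|[Z [ZD eZ hZ]]] := @painting P e c.
- by rewrite PE (partN eX) (negbTE eY) orbT.
- by rewrite PE (negbTE neg_g) negbK eX.
- have sepg V : V \in [set X; Y] -> forall j d,
      j \in part d T -> j \in part (~~ d) V -> j = g.
    rewrite !inE => /orP[]/eqP-> j d /hT; rewrite PE => /orP[/eqP//|/andP[nX nY]].
      by rewrite (negbTE nX).
    by rewrite (negbTE nY).
  have orthX : orthogonal T X by move: XD; rewrite inE => /forall_inP/(_ T TC).
  have orthY : orthogonal T Y by move: YD; rewrite inE => /forall_inP/(_ T TC).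
  have [j [d [jT jX]]] := orthogonalS orthX eT eX.
  have jg : j = g by apply: (sepg X _ _ d); rewrite ?inE ?eqxx.
  rewrite {}jg in jT jX.
  have db : d = ~~ b.
    apply/eqP; apply: contraT => ndb; have edb : d = b by case: (d) (b) ndb => [] [].
    by rewrite edb (partN gX) in jX.
  rewrite db in jT.
  have [k [u [kT kY]]] := orthogonalS orthY jT gY.
  have kg : k = g by apply: (sepg Y _ _ u); rewrite ?inE ?eqxx ?orbT.
  rewrite kg in kT kY; have := partN gY; have := partN jT; rewrite negbK.
  by case: (u) (b) kT kY => [] [] /= h1 h2; rewrite ?h1 ?h2.
- exists Z; split=> //.
    by apply/negP => /suppP[d /hZ]; rewrite PE eqxx.
  move=> d k /hZ; rewrite PE negb_or negb_and !negbK => /andP[_ /orP].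
  by [].
Qed.

Lemma min_covector_sub W : W \in D -> supp W != set0 ->
  exists2 Z, Z \in min_supp D & forall d k, k \in part d Z -> k \in part d W.
Proof.
move=> WD W0; have [m] := ubnP #|supp W|.
elim: m W WD W0 => // m IH W WD W0; rewrite ltnS => leW.
case: (boolP (W \in min_supp D)) => [|nW]; first by exists W.
suff [U [UD U0 pUW hU]] : exists U, [/\ U \in D, supp U != set0,
    supp U \proper supp W & forall d k, k \in part d U -> k \in part d W].
  have [|Z ZD hZ] := IH U UD U0; first exact: leq_trans (proper_card pUW) leW.
  by exists Z => // d k /hZ/hU.
move: nW; rewrite inE WD W0 /= negb_forall_in => /exists_inP[U UD].
rewrite negb_imply negbK => /andP[U0 pUW].
have [k] := ubnP #|separation U W|.
elim: k U UD U0 pUW => // k IHk U UD U0 pUW; rewrite ltnS => lek.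
have [s0|[h /separationP[d [hU hW]]]] := set_0Vmem (separation U W).
  exists U; split=> // d j jU.
  have /suppP[u jW] := subsetP (proper_sub pUW) _ (supp_part jU).
  case: (eqVneq d u) jW => [->//|ndu] jW.
  suff : j \in separation U W by rewrite s0 inE.
  by apply/separationP; exists d; split=> //; case: (d) (u) ndu jW => [] [].
have [sUW [e /suppP[c eW] eU]] := properP pUW.
have eU' : e \notin part (~~ c) U by apply: contra eU => /supp_part.
have [|T [TD eT hT cT]] :=
  covector_strong_elim WD UD hW (_ : h \in part (~~ ~~ d) U) eW eU'.
  by rewrite negbK.
apply: (IHk T) => //.
- by apply/set0Pn; exists e; apply: supp_part eT.
- apply/properP; split.
    apply: subset_trans (supp_sub_cover cT) _; rewrite subUset subxx.
    exact: sUW.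
  by exists h => //; apply: supp_part hW.
- apply: leq_trans lek; apply: proper_card; apply/properP; split.
    apply/subsetP => j /separationP[u [jT jW]]; apply/separationP; exists u.
    by split=> //; case: (cT _ _ jT) => // jW'; rewrite (partN jW') in jW.
  exists h; first by apply/separationP; exists d.
  by apply: contra hT => /separationP[u [/supp_part]].
Qed.

Lemma min_suppP (S : {set signed_set E}) X :
  reflect [/\ X \in S, supp X != set0 & forall Y, Y \in S -> supp Y != set0 ->
             ~~ (supp Y \proper supp X)] (X \in min_supp S).
Proof.
rewrite inE; apply: (iffP and3P) => [[XS X0 /forall_inP h]|[XS X0 h]].
  by split=> // Y YS Y0; apply: implyP (h Y YS) Y0.
by split=> //; apply/forall_inP => Y YS; apply/implyP; apply: h.
Qed.

Fact cocircuit_neq0 X : X \in cocircuits M -> supp X != set0.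
Proof. by case/min_suppP. Qed.

Fact cocircuit_opp X : X \in cocircuits M -> opp X \in cocircuits M.
Proof.
case/min_suppP=> XD X0 h; apply/min_suppP; rewrite supp_opp.
by split=> //; apply: covector_opp.
Qed.

Fact cocircuit_incomparable X Y : X \in cocircuits M -> Y \in cocircuits M ->
  supp X \subset supp Y -> X = Y \/ X = opp Y.
Proof.
case/min_suppP=> XD X0 _ /min_suppP[YD Y0 minY] sXY.
have eXY : supp X = supp Y.
  by apply/eqP; move: (minY X XD X0); rewrite properEneq sXY andbT negbK.
have [a0|[e /agreementP[c [eX eY]]]] := set_0Vmem (agreement X Y).
  right; apply: signed_set_eq => b; rewrite part_opp; apply/setP => k.
  apply/idP/idP => kX.
    have : k \in supp Y by rewrite -eXY (supp_part kX).
    case/suppP=> u kY; case: (eqVneq u b) kY => [->|nub] kY.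
      suff : k \in agreement X Y by rewrite a0 inE.
      by apply/agreementP; exists b.
    by case: (u) (b) nub kY => [] [].
  have : k \in supp X by rewrite eXY (supp_part kX).
  case/suppP=> u kY; case: (eqVneq u b) kY => [->//|nub] kY.
  suff : k \in agreement X Y by rewrite a0 inE.
  by apply/agreementP; exists u; split=> //; case: (u) (b) nub kX => [] [].
have [s0|[g /separationP[b [gX gY]]]] := set_0Vmem (separation X Y).
  left; apply: signed_set_eq => b; apply/setP => k.
  apply/idP/idP => kX.
    have : k \in supp Y by rewrite -eXY (supp_part kX).
    case/suppP=> u kY; case: (eqVneq u b) kY => [->//|nub] kY.
    suff : k \in separation X Y by rewrite s0 inE.
    by apply/separationP; exists b; split=> //; case: (u) (b) nub kY => [] [].
  have : k \in supp X by rewrite eXY (supp_part kX).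
  case/suppP=> u kY; case: (eqVneq u b) kY => [->//|nub] kY.
  suff : k \in separation X Y by rewrite s0 inE.
  by apply/separationP; exists u; split=> //; case: (u) (b) nub kX => [] [].
have [|Z [ZD eZ gZ hZ]] :=
  covector_strong_elim XD YD gX gY eX (_ : e \notin part (~~ c) Y).
  by rewrite (partN eY).
have Z0 : supp Z != set0 by apply/set0Pn; exists e; apply: supp_part eZ.
case/negP: (minY Z ZD Z0); apply/properP; split.
  by have := supp_sub_cover hZ; rewrite eXY setUid.
by exists g => //; apply: supp_part gY.
Qed.

Fact cocircuit_elimination X Y e :
  X \in cocircuits M -> Y \in cocircuits M ->
  X <> opp Y -> e \in pos X -> e \in neg Y ->
  exists2 Z, Z \in cocircuits M &
    pos Z \subset (pos X :|: pos Y) :\ e /\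
    neg Z \subset (neg X :|: neg Y) :\ e.
Proof.
case/min_suppP=> XD X0 _ /min_suppP[YD Y0 _] nXY eX eY.
suff [W [WD W0 eW hW]] : exists W, [/\ W \in D, supp W != set0,
    e \notin supp W &
    forall d k, k \in part d W -> k \in part d X \/ k \in part d Y].
  have [Z ZD hZ] := min_covector_sub WD W0; exists Z => //.
  have sub d : part d Z \subset (part d X :|: part d Y) :\ e.
    apply/subsetP => k /hZ kW; rewrite in_setD1; apply/andP; split.
      by apply: contraNneq eW => <-; apply: supp_part kW.
    by rewrite inE; apply/orP; apply: hW.
  by split; [apply: (sub true)|apply: (sub false)].
have el A B b c g : A \in D -> B \in D -> e \in part b A ->
    e \in part (~~ b) B -> g \in part c A -> g \notin part (~~ c) B ->
    exists W, [/\ W \in D, supp W != set0, e \notin supp W &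
      forall d k, k \in part d W -> k \in part d A \/ k \in part d B].
  move=> AD BD eA eB gA gB.
  have [W [WD gW eW hW]] := covector_strong_elim AD BD eA eB gA gB.
  by exists W; split=> //; apply/set0Pn; exists g; apply: supp_part gW.
case: (boolP [exists c, exists g, (g \in part c X) && (g \notin part (~~ c) Y)]).
  case/existsP=> c /existsP[g /andP[gX gY]].
  exact: (el X Y true c g).
move/existsPn=> nX.
case: (boolP [exists c, exists g, (g \in part c Y) && (g \notin part (~~ c) X)]).
  case/existsP=> c /existsP[g /andP[gY gX]].
  have [W [WD W0 eW hW]] := el Y X false c g YD XD eY eX gY gX.
  by exists W; split=> // d k /hW[]; [right|left].
move/existsPn=> nY; case: nXY; apply: signed_set_eq => b; rewrite part_opp.
apply/setP => k; apply/idP/idP => kb.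
  by have /existsPn/(_ k) := nX b; rewrite kb negbK.
by have /existsPn/(_ k) := nY (~~ b); rewrite kb !negbK.
Qed.

Definition dual : oriented_matroid E :=
  OrientedMatroid cocircuit_neq0 cocircuit_opp cocircuit_incomparable
    cocircuit_elimination.

End Duality.

Section Reorientation.

Variables (E : finType) (f : E).
Implicit Types X Y Z : signed_set E.

Lemma mem_part_reorient b X e :
  (e \in part b (reorient f X)) = (e \in part (b (+) (e == f)) X).
Proof.
by case: b; rewrite !inE; case: (e == f); rewrite /= ?andbT ?andbF ?orbF.
Qed.

Lemma reorientK : involutive (reorient f).
Proof.
move=> X; apply: signed_set_eq => b; apply/setP => e.
by rewrite !mem_part_reorient -addbA addbb addbF.
Qed.

Lemma reorient_opp X : reorient f (opp X) = opp (reorient f X).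
Proof.
apply: signed_set_eq => b; apply/setP => e.
by rewrite part_opp !mem_part_reorient part_opp addNb.
Qed.

Lemma supp_reorient X : supp (reorient f X) = supp X.
Proof.
apply/setP => e; apply/suppP/suppP => -[b].
  by rewrite mem_part_reorient; exists (b (+) (e == f)).
by exists (b (+) (e == f)); rewrite mem_part_reorient -addbA addbb addbF.
Qed.

Variable M : oriented_matroid E.

Definition reorient_circuits : {set signed_set E} :=
  [set reorient f X | X in circuits M].

Fact reorient_circuit_neq0 X : X \in reorient_circuits -> supp X != set0.
Proof. by case/imsetP=> Y YC ->; rewrite supp_reorient (circuit_neq0 YC). Qed.

Fact reorient_circuit_opp X :
  X \in reorient_circuits -> opp X \in reorient_circuits.
Proof.
by case/imsetP=> Y YC ->; rewrite -reorient_opp imset_f // circuit_opp.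
Qed.

Fact reorient_circuit_incomparable X Y :
  X \in reorient_circuits -> Y \in reorient_circuits ->
  supp X \subset supp Y -> X = Y \/ X = opp Y.
Proof.
case/imsetP=> {}X XC -> /imsetP[{}Y YC ->]; rewrite !supp_reorient => sXY.
by case: (circuit_incomparable XC YC sXY) => ->; [left|right; rewrite reorient_opp].
Qed.

Fact reorient_circuit_elimination X Y e :
  X \in reorient_circuits -> Y \in reorient_circuits ->
  X <> opp Y -> e \in pos X -> e \in neg Y ->
  exists2 Z, Z \in reorient_circuits &
    pos Z \subset (pos X :|: pos Y) :\ e /\
    neg Z \subset (neg X :|: neg Y) :\ e.
Proof.
case/imsetP=> {}X XC -> /imsetP[{}Y YC ->]; rewrite -reorient_opp => nXY.
rewrite -[pos _]/(part true _) -[neg _]/(part false _) !mem_part_reorient.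
move=> eX; rewrite -[false]/(~~ true) addNb => eY.
have {}nXY : X <> opp Y by move=> eXY; case: nXY; rewrite eXY.
have [Z [ZC eZ hZ]] := weak_elim XC YC nXY eX eY.
have sub d : part d (reorient f Z) \subset
    (part d (reorient f X) :|: part d (reorient f Y)) :\ e.
  apply/subsetP => k; rewrite mem_part_reorient => kZ; rewrite in_setD1 inE.
  rewrite !mem_part_reorient; apply/andP; split; last by apply/orP; apply: hZ.
  by apply: contraNneq eZ => <-; apply: supp_part kZ.
exists (reorient f Z); first exact: imset_f.
by split; [apply: (sub true)|apply: (sub false)].
Qed.

Definition reorientation : oriented_matroid E :=
  OrientedMatroid reorient_circuit_neq0 reorient_circuit_opp
    reorient_circuit_incomparable reorient_circuit_elimination.

End Reorientation.

(* The void complex, without any face, is allowed: it is the Alexander dual of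
   the full simplex. *)
Record simplicial_complex (V : finType) := SimplicialComplex {
  faces : {set {set V}};
  faces_closed :
    [forall s in faces, forall t : {set V}, (t \subset s) ==> (t \in faces)]
}.

HB.instance Definition _ (V : finType) := [isSub for @faces V].

Definition facets (V : finType) (K : simplicial_complex V) : {set {set V}} :=
  [set s | maxset (fun t => t \in faces K) s].

Section Complexes.

Variable V : finType.
Implicit Types (K : simplicial_complex V) (s t : {set V}).

Definition generated_faces (G : {set {set V}}) : {set {set V}} :=
  [set s : {set V} | [exists t in G, s \subset t]].

Fact generated_subproof (G : {set {set V}}) :
  [forall s in generated_faces G, forall t : {set V},
    (t \subset s) ==> (t \in generated_faces G)].
Proof.
apply/forall_inP => s; rewrite inE => /exists_inP[u uG su].
apply/forallP => t; apply/implyP => ts; rewrite inE; apply/exists_inP.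
by exists u => //; apply: subset_trans su.
Qed.

Definition generated_complex (G : {set {set V}}) : simplicial_complex V :=
  SimplicialComplex (generated_subproof G).

Lemma facets_generated (G : {set {set V}}) :
  {in G &, forall s t, s \subset t -> s = t} ->
  facets (generated_complex G) = G.
Proof.
move=> antiG; apply/setP => s; rewrite inE; apply/maxsetP/idP.
  rewrite inE => -[/exists_inP[t tG st]] maxs.
  by rewrite -(maxs t) // inE; apply/exists_inP; exists t.
move=> sG; split; first by rewrite inE; apply/exists_inP; exists s.
move=> t; rewrite inE => /exists_inP[u uG tu] st.
have esu := antiG s u sG uG (subset_trans st tu).
by apply/eqP; rewrite eqEsubset st andbT esu.
Qed.

Definition alexander_dual_faces K : {set {set V}} :=
  [set ~: s | s : {set V} & s \notin faces K].

Fact alexander_dual_subproof K :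
  [forall s in alexander_dual_faces K, forall t : {set V},
    (t \subset s) ==> (t \in alexander_dual_faces K)].
Proof.
apply/forall_inP => _ /imsetP[s sK ->].
apply/forallP => t; apply/implyP => ts; apply/imsetP; exists (~: t); last by rewrite setCK.
move: sK; rewrite !inE; apply: contra => tK.
have /forall_inP/(_ _ tK)/forallP/(_ s)/implyP := faces_closed K; apply.
by rewrite -setCS setCK.
Qed.

Definition alexander_dual K : simplicial_complex V :=
  SimplicialComplex (alexander_dual_subproof K).

End Complexes.

(* [option 'I_n] is the ground set {1, ..., n} together with f = [None]; in
   ['I_n + 'I_n], the vertices x_i and y_j are [inl i] and [inr j]. *)
Definition ground (n : nat) : finType := option 'I_n.
Definition vertex (n : nat) : finType := ('I_n + 'I_n)%type.
Definition distinguished (n : nat) : ground n := None.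

Definition cocircuit_vertices (n : nat) (C : signed_set (ground n)) :
    {set vertex n} :=
  [set inl i | i : 'I_n & Some i \in pos C] :|:
  [set inr j | j : 'I_n & Some j \in neg C].

Definition Delta_facets (n : nat) (N : oriented_matroid (ground n)) :
    {set {set vertex n}} :=
  [set ~: cocircuit_vertices C
    | C in cocircuits N & distinguished n \in pos C].

Definition Delta (n : nat) (N : oriented_matroid (ground n)) :
    simplicial_complex (vertex n) :=
  generated_complex (Delta_facets N).

Lemma facets_Delta (n : nat) (N : oriented_matroid (ground n)) :
  facets (Delta N) = Delta_facets N.
Proof.
apply: facets_generated => _ _ /imsetP[C + ->] /imsetP[D + ->].
move=> /[1!inE]/andP[CN fC] /[1!inE]/andP[DN fD]; rewrite setCS => sDC.
suff sub : supp D \subset supp C.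
  have [->//|eDC] := cocircuit_incomparable DN CN sub.
  have : distinguished n \in part false C.
    by rewrite -[false]/(~~ true) -part_opp -eDC.
  by rewrite (partN (fC : _ \in part true C)).
have inlE (C' : signed_set (ground n)) i :
    (inl i \in cocircuit_vertices C') = (Some i \in pos C').
  rewrite inE; apply/orP/idP => [[]/imsetP[j]|iC].
  - by rewrite inE => ? [->].
  - by [].
  - by left; apply/imsetP; exists i; rewrite ?inE.
have inrE (C' : signed_set (ground n)) i :
    (inr i \in cocircuit_vertices C') = (Some i \in neg C').
  rewrite inE; apply/orP/idP => [[]/imsetP[j]|iC].
  - by [].
  - by rewrite inE => ? [->].
  - by right; apply/imsetP; exists i; rewrite ?inE.
apply/subsetP => -[i|]; last by move=> _; apply: supp_part (fC : _ \in part true C).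
rewrite inE -inlE -inrE => /orP[]/(subsetP sDC).
  by rewrite inlE inE => ->.
by rewrite inrE inE => ->; rewrite orbT.
Qed.

(* Main.v *)
Require Import Defs.
From mathcomp Require Import all_boot.

(** Let [N] be the dual of [M] with [f] reoriented: its circuits are the
    cocircuits of [M] with the sign of [f] reversed. A set [s] of vertices is a
    face of the Alexander dual of [Delta M] iff no circuit of [N] that is
    negative at [f] has all its other signed elements in [s], and it is a face
    of [Delta N] iff some cocircuit of [N] that is positive at [f] has no signed
    element in [s]. The painting lemma for [N] says that one of the two objects
    exists, and orthogonality in [N] forbids both: a circuit and a cocircuit
    that disagree at [f] agree at some other element. *)

Section CocircuitThroughElement.

Variables (E : finType) (M : oriented_matroid E).
Implicit Types T U W Z : signed_set E.
Local Notation D := (covectors (circuits M)).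

(** A cocircuit [U] conformal to [W] has smaller support, as equal supports would force [U = W]. If
    [U] contains [e], it is the witness; otherwise [W] is eliminated against [opp U]. *)
Lemma proper_covector_through W e c : W \in D -> e \in part c W ->
  W \notin cocircuits M ->
  exists T, [/\ T \in D, e \in part c T & supp T \proper supp W].
Proof.
move=> WD eW nW.
have W0 : supp W != set0 by apply/set0Pn; exists e; apply: supp_part eW.
have [U UM hU] := min_covector_sub WD W0.
have /min_suppP[UD U0 _] := UM.
have sUW : supp U \subset supp W.
  by apply/subsetP => k /suppP[d /hU kW]; apply: supp_part kW.
have pUW : supp U \proper supp W.
  rewrite properEneq sUW andbT; apply: contraNneq nW => eUW.
  suff <- : U = W by [].
  apply: signed_set_eq => d; apply/setP => k; apply/idP/idP => [/hU//|kW].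
  have /suppP[u kU] : k \in supp U by rewrite eUW; apply: supp_part kW.
  case: (eqVneq u d) kU => [->//|nud] /hU kW'.
  suff : k \in part (~~ d) W by rewrite (partN kW).
  by case: (u) (d) nud kW' => [] [].
have [/suppP[d eU]|eU] := boolP (e \in supp U).
  exists U; split=> //; case: (eqVneq d c) eU => [->//|ndc] /hU eW'.
  suff : e \in part (~~ c) W by rewrite (partN eW).
  by case: (d) (c) ndc eW' => [] [].
(* Eliminating any [g] of [U] between [W] and [opp U] keeps [e], which [U] misses, and drops [g]
   from the support of [W]. *)
have /set0Pn[g /suppP[b gU]] := U0.
have [||T [TD eT gT hT]] := covector_strong_elim WD (covector_opp UD)
    (hU _ _ gU) (_ : g \in part (~~ b) (opp U)) eW
    (_ : e \notin part (~~ c) (opp U)).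
- by rewrite part_opp negbK.
- by rewrite part_opp negbK; apply: contra eU => /supp_part.
exists T; split=> //; apply/properP; split.
  apply: subset_trans (supp_sub_cover hT) _.
  by rewrite supp_opp subUset subxx.
by exists g => //; apply: supp_part (hU _ _ gU).
Qed.

(* Eliminating an element of [separation T W] between [T] and [W] shrinks the
   separation from [W] while keeping [e]. *)
Lemma conformal_covector_through W T e c : W \in D -> T \in D ->
  e \in part c W -> e \in part c T -> supp T \proper supp W ->
  exists U, [/\ U \in D, e \in part c U, supp U \proper supp W &
    forall d k, k \in part d U -> k \in part d W].
Proof.
move=> WD + eW; have [m] := ubnP #|separation T W|.
elim: m T => // m IH T; rewrite ltnS => lem TD eT pTW.
have sTW := proper_sub pTW.
have [s0|[h /separationP[d [hT hW]]]] := set_0Vmem (separation T W).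
  exists T; split=> // d j jT.
  have /suppP[u jW] := subsetP sTW _ (supp_part jT).
  case: (eqVneq d u) jW => [->//|ndu] jW.
  suff : j \in separation T W by rewrite s0 inE.
  by apply/separationP; exists d; split=> //; case: (d) (u) ndu jW => [] [].
have eW' : e \notin part (~~ c) W by rewrite (partN eW).
have [Z [ZD eZ hZ cZ]] := covector_strong_elim TD WD hT hW eT eW'.
apply: (IH Z) => //.
- apply: leq_trans lem; apply: proper_card; apply/properP; split.
    apply/subsetP => j /separationP[u [jZ jW]]; apply/separationP; exists u.
    by split=> //; case: (cZ _ _ jZ) => // jW'; rewrite (partN jW') in jW.
  exists h; first by apply/separationP; exists d.
  by apply: contra hZ => /separationP[u [/supp_part]].
- apply/properP; split; last by exists h => //; apply: supp_part hW.
  apply: subset_trans (supp_sub_cover cZ) _; rewrite subUset subxx andbT.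
  exact: sTW.
Qed.

(** The cocircuit from [min_covector_sub] may miss [e], so the descent goes through smaller
    conformal covectors that keep [e], until one is a cocircuit. *)
Lemma cocircuit_through W e c : W \in D -> e \in part c W ->
  exists Z, [/\ Z \in cocircuits M, e \in part c Z &
    forall d k, k \in part d Z -> k \in part d W].
Proof.
have [m] := ubnP #|supp W|.
elim: m W => // m IH W; rewrite ltnS => leW WD eW.
have [WM|nW] := boolP (W \in cocircuits M); first by exists W.
have [T [TD eT pTW]] := proper_covector_through _ _ _ WD eW nW.
have [U [UD eU pUW hU]] := conformal_covector_through _ _ _ _ WD TD eW eT pTW.
have [Z [ZM eZ hZ]] := IH U (leq_trans (proper_card pUW) leW) UD eU.
by exists Z; split=> // d k /hZ/hU.
Qed.

End CocircuitThroughElement.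

Section Vertices.

Variable n : nat.
Implicit Types (C T : signed_set (ground n)) (s : {set vertex n}).
Local Notation f := (distinguished n).

Definition signed_vertex (i : 'I_n) (b : bool) : vertex n :=
  if b then inl i else inr i.

Lemma mem_cocircuit_vertices C i b :
  (signed_vertex i b \in cocircuit_vertices C) = (Some i \in part b C).
Proof.
case: b; rewrite inE; apply/orP/idP => /= [[]/imsetP[j]|iC] //.
- by rewrite inE => ? [->].
- by left; apply/imsetP; exists i; rewrite ?inE.
- by rewrite inE => ? [->].
- by right; apply/imsetP; exists i; rewrite ?inE.
Qed.

Lemma cocircuit_vertices_subP C s :
  reflect (forall i b, Some i \in part b C -> signed_vertex i b \in s)
          (cocircuit_vertices C \subset s).
Proof.
apply: (iffP subsetP) => [sCs i b iC|h].
  by apply: sCs; rewrite mem_cocircuit_vertices.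
by case=> i; [have := h i true|have := h i false];
  rewrite -mem_cocircuit_vertices.
Qed.

Variable N : oriented_matroid (ground n).

Lemma mem_Delta s :
  reflect (exists C, [/\ C \in cocircuits N, f \in pos C &
             cocircuit_vertices C \subset ~: s])
          (s \in faces (Delta N)).
Proof.
rewrite inE; apply: (iffP exists_inP) => [[_ /imsetP[C + ->] sC]|[C [CN fC sC]]].
  by rewrite inE => /andP[CN fC]; exists C; rewrite subsetC.
exists (~: cocircuit_vertices C); last by rewrite subsetC.
by apply/imsetP; exists C; rewrite // inE CN.
Qed.

(** Trades cocircuits of [N] for circuits; when [N] is the reoriented dual of [M], these are
    reoriented cocircuits of [M], which define [Delta M]. *)
Lemma mem_Delta_circuits s :
  s \in faces (Delta N) <->
  ~ exists T, [/\ T \in circuits N, f \in neg T &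
      cocircuit_vertices T \subset s].
Proof.
split=> [/mem_Delta[C [CN fC /cocircuit_vertices_subP hC]]|noT].
  case=> T [TN fT /cocircuit_vertices_subP hT].
  have /min_suppP[+ _ _] := CN; rewrite inE => /forall_inP/(_ T TN) oTC.
  have [[i|] [b [iT iC]]] :=
      orthogonalA oTC (fT : f \in part false T) (fC : f \in part true C).
    by have := hC _ _ iC; rewrite inE (hT _ _ iT).
  (* The agreement cannot occur at [f], where the signs differ. *)
  case: b iT iC => iT iC.
    by have := partN (fT : f \in part false T); rewrite iT.
  by have := partN (fC : f \in part true C); rewrite iC.
(* The painting allows the signed elements whose vertex is in [s], and at [f] only the negative
   sign. *)
pose P : {set ground n * bool} :=
  [set p | if p.1 is Some i then signed_vertex i p.2 \in s else ~~ p.2].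
have [||[T [TN fT hT]]|[Y [YD fY hY]]] := @painting _ N P f false.
- by rewrite inE.
- by rewrite inE.
- case: noT; exists T; split=> //; apply/cocircuit_vertices_subP => i b /hT.
  by rewrite inE.
(* The signs of [Y] are opposite to forbidden ones, so those of [opp Y] are themselves forbidden:
   its vertices avoid [s]. *)
have fY' : f \in part true (opp Y) by [].
have [C [CN fC hC]] := cocircuit_through _ _ _ _ _ (covector_opp YD) fY'.
apply/mem_Delta; exists C; split=> //; apply/cocircuit_vertices_subP => i b /hC.
by rewrite part_opp => /hY; rewrite negbK !inE.
Qed.

End Vertices.

(** Holds because [f] has no vertex. *)
Lemma cocircuit_vertices_reorient n (C : signed_set (ground n)) :
  cocircuit_vertices (reorient (distinguished n) C) = cocircuit_vertices C.
Proof.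
have E i b : (signed_vertex n i b \in
    cocircuit_vertices (reorient (distinguished n) C)) =
    (signed_vertex n i b \in cocircuit_vertices C).
  by rewrite !mem_cocircuit_vertices mem_part_reorient addbF.
by apply/setP => -[] i; [have := E i true|have := E i false].
Qed.

Lemma mem_neg_reorient (E : finType) (f : E) X :
  (f \in neg (reorient f X)) = (f \in pos X).
Proof. by have := mem_part_reorient f false X f; rewrite eqxx. Qed.

Lemma mem_alexander_dual (V : finType) (K : simplicial_complex V) s :
  (s \in faces (alexander_dual K)) = (~: s \notin faces K).
Proof.
apply/imsetP/idP => [[t + ->]|sK]; first by rewrite inE setCK.
by exists (~: s); rewrite ?inE ?setCK.
Qed.

Theorem theorem1p1 (n : nat) (M : oriented_matroid (ground n)) :
  alexander_dual (Delta M)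
  = Delta (reorientation (distinguished n) (dual M)).
Proof.
apply: val_inj; apply/setP => s; rewrite -[val _]/(faces _) mem_alexander_dual.
(* Both sides now exclude the same objects: reorienting [f] matches cocircuits of [M] positive at
   [f] with circuits negative at [f], on the same vertices. *)
apply/idP/idP => [nsM|/mem_Delta_circuits noT].
  apply/mem_Delta_circuits => -[_ [/imsetP[C CM ->]]]; rewrite mem_neg_reorient.
  rewrite cocircuit_vertices_reorient => fC sC; case/mem_Delta: nsM.
  by exists C; rewrite setCK.
apply/mem_Delta => -[C [CM fC sC]]; rewrite setCK in sC.
apply: noT; exists (reorient (distinguished n) C); split.
- exact: imset_f.
- by rewrite mem_neg_reorient.
- by rewrite cocircuit_vertices_reorient.
Qed.
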